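(* Let $m\ge2$, $n\ge1$, and let $\mathcal A\in\mathcal S^m(\mathbb C^n)$ be a symmetric tensor with a decomposition $\mathcal A=\sum_{i=1}^R\mathbf a_i^{\otimes m}$, $\mathbf a_i\in\mathbb C^n$, such that the matrix $A=[\mathbf a_1,\dots,\mathbf a_R]\in\mathbb C^{n\times R}$ has full rank $R=\operatorname{mrank}(\mathcal A)=s\leq n$. Then $$\operatorname{gm}(0)=n-s,$$ and therefore $$\operatorname{am}(0)\geq (n-s)(m-1)^{n-1}\geq \operatorname{gm}(0)(m-1)^{\operatorname{gm}(0)-1}.$$
   Context: $\mathbb T(\mathbb C^n,m)=\otimes^m\mathbb C^n$ is the space of $m$-th order $n$-dimensional complex tensors $\mathcal T=(t_{i_1\ldots i_m})$, and $\mathcal S^m(\mathbb C^n)$ is its subspace of symmetric tensors (entries invariant under all permutations of the $m$ indices). For $\mathbf x\in\mathbb C^n$, $\mathcal T\mathbf x^{m-1}\in\mathbb C^n$ has $i$-th entry $\sum_{i_2,\dots,i_m=1}^n t_{ii_2\ldots i_m}x_{i_2}\cdots x_{i_m}$, and $\mathbf x^{[m-1]}$ has $i$-th entry $x_i^{m-1}$. The identity tensor $\mathcal I$ has entries $1$ when $i_1=\dots=i_m$ and $0$ otherwise. A number $\lambda\in\mathbb C$ is an eigenvalue of $\mathcal T$ if there is $\mathbf x\neq\mathbf 0$ with $\mathcal T\mathbf x^{m-1}=\lambda\mathbf x^{[m-1]}$. The eigenvariety is $V(\lambda)=\{\mathbf x\in\mathbb C^n:\mathcal T\mathbf x^{m-1}=\lambda\mathbf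 x^{[m-1]}\}$ (with $\mathbf 0$ included). The determinant $\operatorname{Det}(\mathcal T)$ is the classical resultant of the $n$ homogeneous polynomials $(\mathcal T\mathbf x^{m-1})_i$, $i=1,\dots,n$, of degree $m-1$ in $n$ variables (the irreducible integer polynomial in the coefficients vanishing if and only if the system has a nontrivial common zero in $\mathbb C^n$, normalized to be $1$ at $(x_1^{m-1},\dots,x_n^{m-1})$). The characteristic polynomial is $\chi(\lambda)=\operatorname{Det}(\lambda\mathcal I-\mathcal T)$, monic of degree $n(m-1)^{n-1}$, whose roots are exactly the eigenvalues. $\operatorname{am}(\lambda)$ is the multiplicity of $\lambda$ as a root of $\chi$ (it is $0$ if $\lambda$ is not a root), and $\operatorname{gm}(\lambda)=\dim V(\lambda)$ as an affine variety in $\mathbb C^n$ (it is $0$ if $V(\lambda)=\{\mathbf 0\}$). The marginal rank $\operatorname{mrank}(\mathcal A)$ is the rank of the matrix $[\mathbf a_1,\dots,\mathbf a_R]$ for a decomposition $\mathcal A=\sum_{i=1}^R\mathbf a_i^{\otimes m}$ with $R$ minimal; it does not depend on the choice of such a decomposition. *)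

(* Defs.v *)
From mathcomp Require Import all_boot all_order all_fingroup all_algebra.
From mathcomp Require Import boolp classical_sets reals.
From mathcomp Require Import complex.
From mathcomp Require Import mpoly.

Set Implicit Arguments.
Unset Strict Implicit.
Unset Printing Implicit Defensive.

Import GRing.Theory.
Local Open Scope ring_scope.
Local Open Scope classical_set_scope.

Section Tensors.
Variable K : comNzRingType.

(* An entry is indexed by the multi-index k |-> i_k, with k ranging over 'I_m. *)
Definition tensor (n m : nat) : Type := {ffun {ffun 'I_m -> 'I_n} -> K}.

Definition symmetric_tensor n m (T : tensor n m) : Prop :=
  forall (s : 'S_m) (j : {ffun 'I_m -> 'I_n}), T [ffun k => j (s k)] = T j.

Definition id_tensor n m : tensor n m :=
  [ffun j : {ffun 'I_m -> 'I_n} => [forall k, forall l, j k == j l]%:R].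

(* T x^(m-1).  For m > 0 the list i :: j has length m, so [nth] never falls
   back on its default value; m = 0 is not meaningful. *)
Definition tapply n m (T : tensor n m) (x : 'cV[K]_n) : 'cV[K]_n :=
  \col_i \sum_(j : m.-1.-tuple 'I_n)
    T [ffun k : 'I_m => nth i (i :: j) k] * \prod_(l <- j) x l 0.

Definition tpower n m (a : 'cV[K]_n) : tensor n m :=
  [ffun j : {ffun 'I_m -> 'I_n} => \prod_k a (j k) 0].

Definition sym_decomp n m r (T : tensor n m) (a : 'I_r -> 'cV[K]_n) : Prop :=
  T = \sum_(k < r) tpower m (a k).

Definition decomp_mx n r (a : 'I_r -> 'cV[K]_n) : 'M[K]_(n, r) :=
  \matrix_(i, k) a k i 0.

End Tensors.

(* The forms (T x^(m-1))_i, obtained by applying T to the generic vector. *)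
Definition tensor_forms (K : comNzRingType) n m (T : tensor K n m)
    (i : 'I_n) : {mpoly K[n]} :=
  tapply ([ffun j => (T j)%:MP] : tensor {mpoly K[n]} n m) (\col_l 'X_l) i 0.

Section Resultant.

(* The coefficients of a system of n forms of degree d in n variables: the pair
   (i, e) stands for the coefficient of the monomial e in the i-th form. *)
Definition coef_index (n d : nat) : finType :=
  ('I_n * {e : 'X_{1..n < d.+1} | mdeg e == d})%type.

Definition coef_of (K : comNzRingType) n d (F : 'I_n -> {mpoly K[n]})
    (k : 'I_#|coef_index n d|) : K :=
  (F (enum_val k).1)@_(val (enum_val k).2).

Definition eval_coefs (K : comNzRingType) n d
    (P : {mpoly int[#|coef_index n d|]}) (F : 'I_n -> {mpoly K[n]}) : K :=
  mmap intr (coef_of F) P.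

Definition irreducible_elt (A : unitRingType) (p : A) : Prop :=
  [/\ p != 0, p \isn't a GRing.unit
    & forall q r, p = q * r -> q \is a GRing.unit \/ r \is a GRing.unit].

(* For n, d > 0 exactly one P satisfies this: irreducibility together with the
   vanishing condition determines P up to sign, the normalization fixes it. *)
Definition is_resultant (C : closedFieldType) n d
    (P : {mpoly int[#|coef_index n d|]}) : Prop :=
  [/\ irreducible_elt P,
      forall F : 'I_n -> {mpoly C[n]}, (forall i, F i \is d.-homog) ->
        (eval_coefs P F = 0 <->
         exists2 x : 'cV[C]_n, x != 0 & forall i, (F i).@[fun l => x l 0] = 0)
    & eval_coefs P (fun i => 'X_i ^+ d : {mpoly C[n]}) = 1].

End Resultant.

Section Eigen.
Variables (C : fieldType) (n m : nat).
Implicit Types (T : tensor C n m) (Res : {mpoly int[#|coef_index n m.-1|]}).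

(* Tensor determinants and characteristic polynomials take as argument the
   resultant Res of n forms of degree m - 1 in n variables. *)
Definition tensor_det (K : comNzRingType) Res (T : tensor K n m) : K :=
  eval_coefs Res (tensor_forms T).

Definition tensor_charpoly Res T : {poly C} :=
  tensor_det Res
    ([ffun j => 'X * id_tensor {poly C} n m j - (T j)%:P]
       : tensor {poly C} n m).

Definition am Res T (lambda : C) : nat := mup lambda (tensor_charpoly Res T).

Definition eigenvariety T (lambda : C) : set 'cV[C]_n :=
  [set x | tapply T x = lambda *: \col_i (x i 0) ^+ m.-1].

End Eigen.

Section AffineDimension.
Variables (C : fieldType) (n : nat).
Implicit Types V : set 'cV[C]_n.

Definition zariski_closed (Z : set 'cV[C]_n) : Prop :=
  exists S : set {mpoly C[n]},
    Z = [set x | forall p, S p -> p.@[fun i => x i 0] = 0].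

Definition zariski_irreducible (Z : set 'cV[C]_n) : Prop :=
  Z !=set0 /\
  forall Z1 Z2, zariski_closed Z1 -> zariski_closed Z2 ->
    Z `<=` Z1 `|` Z2 -> Z `<=` Z1 \/ Z `<=` Z2.

(* Z 0 `<` Z 1 `<` ... `<` Z k *)
Definition irreducible_chain V (k : nat) (Z : nat -> set 'cV[C]_n) : Prop :=
  (forall i, (i <= k)%N ->
     [/\ zariski_closed (Z i), zariski_irreducible (Z i) & Z i `<=` V]) /\
  (forall i, (i < k)%N -> Z i `<` Z i.+1).

Definition has_krull_dim V (d : nat) : Prop :=
  (exists Z, irreducible_chain V d Z) /\
  (forall k Z, irreducible_chain V k Z -> (k <= d)%N).

(* A nonempty closed V has a unique dimension, so that the default value 0 is
   not used for eigenvarieties, which contain the origin (when m > 1). *)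
Definition affine_dim V : nat := xget 0%N [set d | has_krull_dim V d].

End AffineDimension.

Definition gm (C : fieldType) n m (T : tensor C n m) (lambda : C) : nat :=
  affine_dim (eigenvariety T lambda).

Section MarginalRank.
Variables (C : fieldType) (n m : nat).

Definition minimal_decomp r (T : tensor C n m) (a : 'I_r -> 'cV[C]_n) : Prop :=
  sym_decomp T a /\
  forall r' (b : 'I_r' -> 'cV[C]_n), sym_decomp T b -> (r <= r')%N.

(* The rank of the matrix is the same for all minimal decompositions. *)
Definition mrank (T : tensor C n m) : nat :=
  xget 0%N [set s | exists r (a : 'I_r -> 'cV[C]_n),
                      minimal_decomp T a /\ \rank (decomp_mx a) = s].

End MarginalRank.

(* Main.v *)
(* Geometric multiplicity: A has full column rank, so T x^(m-1) = A (A^T x)^[m-1]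
   vanishes exactly on the kernel of A^T, a linear space of dimension n - s.  Its
   Krull dimension is n - s because polynomials separating the successive terms
   of a chain of irreducible closed sets are algebraically independent on the last
   one, while q + 1 polynomials in q variables are algebraically dependent.

   Algebraic multiplicity: the resultant is homogeneous in the coefficients of each
   form, because its zero set is invariant under scaling a form; the degree is at
   least d^(n-1), d = m - 1, because a suitable system becomes singular for d^(n-1)
   values of a parameter in one of the forms.  It is also invariant under adding to
   a form a combination of the others, since a polynomial without roots is constant.
   As n - s rows of A depend on the other s, such operations turn n - s of the forms
   of lambda I - T into multiples of lambda, and lambda^((n-s) d^(n-1)) factors out. *)

Require Import Defs.
From mathcomp Require Import all_boot all_order all_fingroup all_algebra.
From mathcomp Require Import boolp classical_sets reals.
From mathcomp Require Import complex.
From mathcomp Require Import mpoly.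

Set Implicit Arguments.
Unset Strict Implicit.
Unset Printing Implicit Defensive.

Import GRing.Theory Num.Theory.
Local Open Scope ring_scope.

(** * The resultant as a function of one form *)

Section PolyFacts.
Variable C : closedFieldType.

Lemma poly_eq_horner_neq0 (p q : {poly C}) :
  (forall t, t != 0 -> p.[t] = q.[t]) -> p = q.
Proof.
move=> pq; apply/eqP; rewrite -subr_eq0; apply/negP => /negP nz.
have /closed_nonrootP[t] : (p - q) * 'X != 0 by rewrite mulf_neq0 // polyX_eq0.
rewrite rootE hornerM hornerX !hornerE mulf_eq0 negb_or => /andP[+ t0].
by rewrite pq // subrr eqxx.
Qed.

(** Once the largest power of X is divided out, no root remains, so over a closed field the cofactor
    is a constant. *)
Lemma monomial_of_nonroot (p : {poly C}) :
  (forall t, t != 0 -> p.[t] != 0) -> exists k, p = p.[1] *: 'X^k.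
Proof.
move=> pnz.
have p0 : p != 0.
  by apply: contraTneq (pnz 1 (oner_neq0 _)) => ->; rewrite horner0 eqxx.
have [k [q q0 pE]] := multiplicity_XsubC p 0.
rewrite p0 /= in q0; rewrite subr0 in pE.
have /size_poly1P[c c0 qE] : size q == 1%N.
  apply/closed_rootP => -[t qt]; have [t0|t0] := eqVneq t 0.
    by rewrite t0 (negPf q0) in qt.
  by have := pnz t t0; rewrite pE hornerM (rootP qt) mul0r eqxx.
exists k; rewrite {1}pE qE mul_polyC; congr (_ *: _).
by rewrite pE qE hornerM hornerC hornerXn expr1n mulr1.
Qed.

End PolyFacts.

Section ResultantProperties.
Variables (C : numClosedFieldType) (n d : nat).
Variable Res : {mpoly int[#|coef_index n d|]}.
Hypothesis ResP : is_resultant C Res.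

Local Notation system := ('I_n -> {mpoly C[n]}).
Implicit Types (F G : system) (i : 'I_n) (t u : C).

Definition coefs F (j : coef_index n d) : C := (F j.1)@_(val j.2).

(** Coefficients may lie in any commutative ring; taken in [{poly K}] they give the resultant of a
    family of systems as a polynomial in its parameter. *)
Definition res_at (K : comNzRingType) (c : coef_index n d -> K) : K :=
  mmap intr (fun k => c (enum_val k)) Res.

Lemma rmorph_res_at (K L : comNzRingType) (f : {rmorphism K -> L}) c :
  f (res_at c) = res_at (fun j => f (c j)).
Proof.
rewrite /res_at /mmap rmorph_sum /=; apply: eq_bigr => e _.
rewrite rmorphM /= rmorph_int; congr (_ * _).
by rewrite /mmap1 rmorph_prod; apply: eq_bigr => k _; rewrite rmorphXn.
Qed.

Lemma eq_res_at (K : comNzRingType) (c c' : coef_index n d -> K) :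
  c =1 c' -> res_at c = res_at c'.
Proof. by move=> cc'; congr (mmap _ _ _); apply/funext => k. Qed.

Lemma horner_res_at (K : comNzRingType) (c : coef_index n d -> {poly K}) (z : K) :
  (res_at c).[z] = res_at (fun j => (c j).[z]).
Proof. exact: (rmorph_res_at (horner_eval z)). Qed.

Lemma eval_coefsE F : eval_coefs Res F = res_at (coefs F).
Proof. by []. Qed.

Definition homogeneous F := forall i, F i \is d.-homog.

Lemma eval_coefs_neq0P F : homogeneous F ->
  (eval_coefs Res F != 0 <->
   forall x : 'cV[C]_n, (forall i, (F i).@[fun l => x l 0] = 0) -> x = 0).
Proof.
case: ResP => _ resP _ hF; split=> [nz x xF | zF].
  apply/eqP; apply/negPn/negP => x0; case/eqP: nz.
  by apply/(resP _ hF); exists x.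
apply/eqP => /(resP _ hF)[x x0 xF]; case/eqP: x0; exact: zF.
Qed.

Lemma eval_coefs_neq0_sub F G : homogeneous F -> homogeneous G ->
  (forall x : 'cV[C]_n, (forall i, (G i).@[fun l => x l 0] = 0) ->
     forall i, (F i).@[fun l => x l 0] = 0) ->
  eval_coefs Res F != 0 -> eval_coefs Res G != 0.
Proof.
move=> hF hG GF /(eval_coefs_neq0P hF) F0; apply/(eval_coefs_neq0P hG) => x xG.
by apply: F0; apply: GF.
Qed.

Definition scale_row i t F : system := fun k => if k == i then t *: F k else F k.

Lemma homogeneous_scale i t F : homogeneous F -> homogeneous (scale_row i t F).
Proof. by move=> hF k; rewrite /scale_row; case: ifP => _; rewrite ?dhomogZ ?hF. Qed.

Lemma scale_row_neq0 i t F : homogeneous F -> t != 0 ->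
  eval_coefs Res F != 0 -> eval_coefs Res (scale_row i t F) != 0.
Proof.
move=> hF t0; apply: eval_coefs_neq0_sub (homogeneous_scale i t hF) _ => // x xG k.
have := xG k; rewrite /scale_row; case: ifP => // _; rewrite mevalZ => /eqP.
by rewrite mulf_eq0 (negPf t0) /= => /eqP.
Qed.

Lemma scale_rowK i t F : t != 0 -> scale_row i t^-1 (scale_row i t F) =1 F.
Proof.
move=> t0 k; rewrite /scale_row; case: (k == i) => //.
by rewrite scalerA mulVf // scale1r.
Qed.

Lemma eq_eval_coefs F G : F =1 G -> eval_coefs Res F = eval_coefs Res G.
Proof. by move=> FG; congr (eval_coefs _ _); apply/funext. Qed.

(** The resultant of F with form i multiplied by an indeterminate. Homogeneity in form i means that
    this is a monomial whose exponent does not depend on F. *)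
Definition row_poly i F : {poly C} :=
  res_at (fun j => (if j.1 == i then 'X else 1) * (coefs F j)%:P).

Lemma horner_row_poly i F t : (row_poly i F).[t] = eval_coefs Res (scale_row i t F).
Proof.
rewrite horner_res_at eval_coefsE; apply: eq_res_at => j.
rewrite hornerM hornerC /coefs /scale_row.
by case: ifP => _; rewrite ?hornerX ?hornerC ?mul1r ?mcoeffZ.
Qed.

Lemma row_poly_monomial i F : homogeneous F -> eval_coefs Res F != 0 ->
  exists k, row_poly i F = eval_coefs Res F *: 'X^k.
Proof.
move=> hF nz.
have [|k kP] := @monomial_of_nonroot _ (row_poly i F).
  by move=> t t0; rewrite horner_row_poly scale_row_neq0.
exists k; rewrite kP horner_row_poly; congr (_ *: _); apply: eq_eval_coefs => l.
by rewrite /scale_row scale1r if_same.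
Qed.

(* Along the pencil F + u (G - F), the product of any two distinct coefficients
   of [row_poly] vanishes at every u where the resultant does not; being
   polynomials in u, one of the two is zero. *)
Lemma row_poly_degree i F G k l : homogeneous F -> homogeneous G ->
  eval_coefs Res F != 0 -> eval_coefs Res G != 0 ->
  row_poly i F = eval_coefs Res F *: 'X^k ->
  row_poly i G = eval_coefs Res G *: 'X^l -> k = l.
Proof.
move=> hF hG F0 G0 Fk Gl.
pose H u : system := fun j => F j + u *: (G j - F j).
have hH u : homogeneous (H u).
  by move=> j; rewrite dhomogD ?hF // dhomogZ // dhomogD ?hG // dhomogN hF.
(* The outer variable scales form i; the inner one is the parameter u of the pencil. *)
pose P : {poly {poly C}} :=
  res_at (fun j => (if j.1 == i then 'X else 1)
                   * ((coefs F j)%:P + 'X * (coefs G j - coefs F j)%:P)%:P).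
have PE u : map_poly (horner_eval u) P = row_poly i (H u).
  rewrite (rmorph_res_at (map_poly (horner_eval u))); apply: eq_res_at => j.
  rewrite rmorphM /= map_polyC /= horner_evalE !hornerE.
  congr (_ * _%:P); first by case: ifP => _; rewrite ?map_polyX ?rmorph1.
  by rewrite /coefs mcoeffD mcoeffZ mcoeffB.
have Pcoef u e : (P`_e).[u] = (row_poly i (H u))`_e.
  by rewrite -PE coef_map.
have H0 : H 0 =1 F by move=> j; rewrite /H scale0r addr0.
have H1 : H 1 =1 G by move=> j; rewrite /H scale1r addrC subrK.
have row_eq F1 F2 : F1 =1 F2 -> row_poly i F1 = row_poly i F2.
  by move=> e; congr (row_poly _ _); apply/funext.
apply/eqP/negPn/negP => kl.
pose h : {poly C} := P.[1].
have hE u : h.[u] = eval_coefs Res (H u).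
  rewrite -[LHS]/(horner_eval u P.[1]) -horner_map PE /= horner_evalE hornerC.
  rewrite horner_row_poly; apply: eq_eval_coefs => j.
  by rewrite /scale_row scale1r if_same.
have : P`_k * P`_l * h == 0.
  apply/eqP/poly_eq_horner_neq0 => u _; rewrite horner0 !hornerM !Pcoef hE.
  have [->|nz] := eqVneq (eval_coefs Res (H u)) 0; first by rewrite mulr0.
  have [e ->] := row_poly_monomial i (hH u) nz; rewrite !coefZ !coefXn.
  have [ke|] := eqVneq k e; last by rewrite mulr0 !mul0r.
  by rewrite -ke eq_sym (negPf kl) !mulr0 mul0r.
rewrite !mulf_eq0 -orbA => /or3P[] /eqP z.
- by have := Pcoef 0 k; rewrite z horner0 (row_eq _ _ H0) Fk coefZ coefXn eqxx mulr1
    => /eqP; rewrite eq_sym (negPf F0).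
- by have := Pcoef 1 l; rewrite z horner0 (row_eq _ _ H1) Gl coefZ coefXn eqxx mulr1
    => /eqP; rewrite eq_sym (negPf G0).
- by have := hE 0; rewrite z horner0 (eq_eval_coefs H0) => /eqP; rewrite eq_sym (negPf F0).
Qed.

(** The exponent D is read off at the system of pure powers, whose resultant is 1, and is the same
    wherever the resultant is nonzero. Where it is zero, scaling by t and back shows that it stays
    zero. *)
Lemma eval_coefs_scale_row i : exists D, forall F t, homogeneous F -> t != 0 ->
  eval_coefs Res (scale_row i t F) = t ^+ D * eval_coefs Res F.
Proof.
pose F0 : system := fun j => 'X_j ^+ d.
have hF0 : homogeneous F0.
  move=> j; have hX : ('X_j : {mpoly C[n]}) \is 1.-homog by rewrite dhomogX /= mdeg1.
  by have := dhomogMn d hX; rewrite mul1n.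
have F01 : eval_coefs Res F0 = 1 by case: ResP.
have F00 : eval_coefs Res F0 != 0 by rewrite F01 oner_neq0.
have [D DP] := row_poly_monomial i hF0 F00; exists D => F t hF t0.
have [z|nz] := eqVneq (eval_coefs Res F) 0.
  rewrite z mulr0; apply/eqP/negPn/negP.
  have := scale_row_neq0 i (homogeneous_scale i t hF) (invr_neq0 t0).
  by move=> /[apply]; rewrite (eq_eval_coefs (scale_rowK i F t0)) z eqxx.
have [k kP] := row_poly_monomial i hF nz.
rewrite (row_poly_degree hF0 hF F00 nz DP kP) -horner_row_poly kP.
by rewrite hornerZ hornerXn mulrC.
Qed.

End ResultantProperties.

(** The relation makes p the reversal of q in degree D, so p has degree at most D. *)
Lemma size_le_of_reciprocal (C : closedFieldType) (p q : {poly C}) D :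
  (forall t, t != 0 -> p.[t] = t ^+ D * q.[t^-1]) -> (size p <= D.+1)%N.
Proof.
move=> pq; have [->|p0] := eqVneq p 0; first by rewrite size_poly0.
(* The reversal is taken in degree M, where M - j is never truncated; D - j could be. *)
pose M := size q; pose r := \sum_(j < M) q`_j *: 'X^(M - j).
have szr : (size r <= M.+1)%N.
  apply: (leq_trans (size_sum _ _ _)); apply/bigmax_leqP => j _.
  by rewrite (leq_trans (size_scale_leq _ _)) // size_polyXn ltnS leq_subr.
have pr : 'X^M * p = 'X^D * r.
  apply: poly_eq_horner_neq0 => t t0.
  rewrite !hornerM !hornerXn pq // mulrCA; congr (_ * _).
  rewrite /r horner_sum horner_coef mulr_sumr; apply: eq_bigr => j _.
  rewrite hornerZ hornerXn mulrCA exprVn; congr (_ * _).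
  by rewrite -exprB ?unitfE // ltnW.
have : (size ('X^M * p)%R <= D + M.+1)%N.
  rewrite pr; apply: leq_trans (size_polyMleq _ _) _.
  by rewrite size_polyXn addSn /= leq_add2l.
by rewrite size_mul ?polyXn_eq0 // ?monic_neq0 ?monicXn // size_polyXn /= addnS -addSn addnC leq_add2r.
Qed.

Lemma sum_digits d p v : (v < d ^ p)%N ->
  (\sum_(k < p) d ^ k * (v %/ d ^ k %% d))%N = v.
Proof.
elim: p v => [|p IHp] v; first by rewrite expn0 ltnS leqn0 big_ord0 => /eqP.
have [->|d0] := posnP d; first by rewrite exp0n.
rewrite expnS => vlt; rewrite big_ord_recl expn0 mul1n divn1 /=.
rewrite [RHS](divn_eq v d) addnC; congr (_ + _)%N.
rewrite -[in RHS](IHp (v %/ d)%N) ?ltn_divLR // 1?mulnC //.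
rewrite big_distrr /=; apply: eq_bigr => k _.
by rewrite /bump /= add1n expnS mulnA divnMA.
Qed.

(** * Lower bound for the degree of the resultant in one form *)

Section DegreeBound.
Variables (C : numClosedFieldType) (n d : nat).
Variable Res : {mpoly int[#|coef_index n.+1 d|]}.
Hypotheses (ResP : is_resultant C Res) (d_gt0 : (0 < d)%N).
Variables (i : 'I_n.+1) (D : nat).
Hypothesis DP : forall F t, homogeneous d F -> t != 0 ->
  eval_coefs Res (scale_row i t F) = t ^+ D * eval_coefs Res F :> C.

Let G : {mpoly C[n.+1]} :=
  \sum_(k < n) (d ^ k)%:R *: ('X_(lift i k) * 'X_i ^+ d.-1).

(** Two parameters are kept because form i of [grid t 1] is t times that of [grid 1 t^-1]: this
    reciprocity bounds the degree of [q] by D. *)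
Let grid (a b : C) (j : 'I_n.+1) : {mpoly C[n.+1]} :=
  if j == i then a *: 'X_i ^+ d - b *: G
  else \prod_(e < d) ('X_j - e%:R *: 'X_i).

Let homogX (j : 'I_n.+1) : ('X_j : {mpoly C[n.+1]}) \is 1.-homog.
Proof. by rewrite dhomogX /= mdeg1. Qed.

Let homogXn (j : 'I_n.+1) e : ('X_j ^+ e : {mpoly C[n.+1]}) \is e.-homog.
Proof. by have := dhomogMn e (homogX j); rewrite mul1n. Qed.

Let homogeneous_grid a b : homogeneous d (grid a b).
Proof.
move=> j; rewrite /grid; case: ifP => _.
  apply: rpredB; apply: rpredZ; first exact: homogXn.
  apply: rpred_sum => k _; apply: rpredZ.
  by have := dhomogM (homogX (lift i k)) (homogXn i d.-1); rewrite add1n prednK.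
elim: (d) => [|e IHe]; first by rewrite big_ord0 dhomog1.
rewrite big_ord_recr /=.
have hL : ('X_j - e%:R *: 'X_i : {mpoly C[n.+1]}) \is 1.-homog.
  by apply: rpredB => //; apply: rpredZ.
by have := dhomogM IHe hL; rewrite addn1.
Qed.

Let meval_grid_i a b (x : 'I_n.+1 -> C) :
  (grid a b i).@[x] =
    a * x i ^+ d - b * \sum_(k < n) (d ^ k)%:R * (x (lift i k) * x i ^+ d.-1).
Proof.
rewrite /grid eqxx mevalB !mevalZ rmorphXn /= mevalXU; congr (_ - _ * _).
rewrite /G (raddf_sum (meval x)); apply: eq_bigr => k _ /=.
by rewrite mevalZ mevalM (rmorphXn (meval x)) /= !mevalXU.
Qed.

Let meval_grid_neq a b (x : 'I_n.+1 -> C) j : j != i ->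
  (grid a b j).@[x] = \prod_(e < d) (x j - e%:R * x i).
Proof.
move=> ji; rewrite /grid (negPf ji) (rmorph_prod (meval x)); apply: eq_bigr => e _ /=.
by rewrite mevalB mevalZ !mevalXU.
Qed.

Let q : {poly C} :=
  res_at Res (fun j => if j.1 == i
    then 'X * (('X_i ^+ d)@_(val j.2))%:P - (G@_(val j.2))%:P
    else (coefs (grid 0 0) j)%:P).

Let qE t : q.[t] = eval_coefs Res (grid t 1).
Proof.
rewrite horner_res_at eval_coefsE; apply: eq_res_at => j.
rewrite /coefs /grid; case: ifP => ji; last by rewrite hornerC ji.
by rewrite !hornerE mcoeffB !mcoeffZ mul1r.
Qed.

Let q' : {poly C} :=
  res_at Res (fun j => if j.1 == i
    then (('X_i ^+ d)@_(val j.2))%:P - 'X * (G@_(val j.2))%:P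
    else (coefs (grid 0 0) j)%:P).

Let q'E t : q'.[t] = eval_coefs Res (grid 1 t).
Proof.
rewrite horner_res_at eval_coefsE; apply: eq_res_at => j.
rewrite /coefs /grid; case: ifP => ji; last by rewrite hornerC ji.
by rewrite !hornerE mcoeffB !mcoeffZ mul1r.
Qed.

Let size_q : (size q <= D.+1)%N.
Proof.
apply: (@size_le_of_reciprocal _ _ q') => t t0.
rewrite qE q'E -DP //; apply: eq_eval_coefs => j.
rewrite /scale_row /grid; case: ifP => // _.
by rewrite scalerBr !scalerA mulr1 mulfV.
Qed.

Let q_neq0 : q != 0.
Proof.
(* At t = -1, a zero has x_j = e_j x_i with naturals e_j, and form i becomes -(1 + sum of d^k e_k)
   x_i^d. In characteristic 0 the factor is nonzero, so x = 0. *)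
suff: q.[-1] != 0 by apply: contraNneq => ->; rewrite horner0.
rewrite qE; apply/(eval_coefs_neq0P ResP (homogeneous_grid _ _)) => x xF.
have xj j : j != i -> exists e : 'I_d, x j 0 = e%:R * x i 0.
  move=> ji; have := xF j; rewrite meval_grid_neq // => /eqP.
  by move=> /prodf_eq0[e _]; rewrite subr_eq0 => /eqP; exists e.
have xi : x i 0 = 0.
  have := xF i; rewrite meval_grid_i mulN1r mul1r -opprD => /eqP.
  rewrite oppr_eq0; apply: contraTeq => xi0.
  have /boolp.choice[f fP] (k : 'I_n) : exists e : nat, x (lift i k) 0 = e%:R * x i 0.
    by have [|e ->] := xj (lift i k); [rewrite eq_sym neq_lift | exists e].
  have -> : x i 0 ^+ d + \sum_(k < n) (d ^ k)%:R * (x (lift i k) 0 * x i 0 ^+ d.-1)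
            = (1 + \sum_(k < n) d ^ k * f k)%:R * x i 0 ^+ d.
    rewrite natrD mulrDl mul1r natr_sum mulr_suml; congr (_ + _).
    apply: eq_bigr => k _; rewrite fP natrM -!mulrA -exprS prednK //.
  by rewrite mulf_neq0 ?expf_neq0 // pnatr_eq0.
apply/colP => j; rewrite mxE; have [->//|/xj[e ->]] := eqVneq j i.
by rewrite xi mulr0.
Qed.

Let root_q v : (v < d ^ n)%N -> root q v%:R.
Proof.
move=> vlt; rewrite rootE qE; case: (ResP) => _ rP _.
apply/eqP/(rP _ (homogeneous_grid _ _)).
pose x : 'cV[C]_n.+1 :=
  \col_j if unlift i j is Some k then (v %/ d ^ k %% d)%:R else 1.
have xi : x i 0 = 1 by rewrite mxE unlift_none.
have xl k : x (lift i k) 0 = (v %/ d ^ k %% d)%:R by rewrite mxE liftK.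
exists x.
  by apply: contra_neq (oner_neq0 C) => x0; rewrite -xi x0 mxE.
move=> j; have [k ->|->] := unliftP i j.
  rewrite meval_grid_neq 1?eq_sym ?neq_lift //.
  have e_lt : (v %/ d ^ k %% d < d)%N by rewrite ltn_pmod.
  by rewrite (bigD1 (Ordinal e_lt)) //= xi xl mulr1 subrr mul0r.
rewrite meval_grid_i xi !expr1n mulr1 mul1r -[v in v%:R](sum_digits vlt).
rewrite natr_sum; apply/eqP; rewrite subr_eq0; apply/eqP; apply: eq_bigr => k _.
by rewrite xl mulr1 natrM.
Qed.

(* The system [grid t 1] has a zero at t = 0, ..., d ^ n - 1: with x_i = 1 its
   other coordinates run through {0, ..., d - 1} independently, and [G] reads
   them as the digits of t in base d. *)
Lemma row_degree_bound : (d ^ n <= D)%N.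
Proof.
rewrite -ltnS; apply: leq_trans size_q.
have := @max_poly_roots _ q [seq v%:R | v <- iota 0 (d ^ n)] q_neq0.
rewrite size_map size_iota; apply.
  by apply/allP => _ /mapP[v + ->]; rewrite mem_iota; apply: root_q.
by rewrite map_inj_uniq ?iota_uniq // => v w /eqP; rewrite eqr_nat => /eqP.
Qed.

End DegreeBound.

(** * Row operations on a system of forms *)

Section RowOperations.
Variables (C : numClosedFieldType) (n d : nat).
Variable Res : {mpoly int[#|coef_index n d|]}.
Hypotheses (ResP : is_resultant C Res) (d_gt0 : (0 < d)%N).

Local Notation system := ('I_n -> {mpoly C[n]}).
Implicit Types (F G : system) (S : {set 'I_n}) (t u : C).

Lemma eval_coefs_scale_row_ge (i : 'I_n) :
  exists2 D, (d ^ n.-1 <= D)%N & forall F t, homogeneous d F -> t != 0 ->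
    eval_coefs Res (scale_row i t F) = t ^+ D * eval_coefs Res F.
Proof.
have [D DP] := eval_coefs_scale_row ResP i; exists D => //.
case: n Res ResP i DP => [|n'] Res' Res'P i DP; first by case: i {DP}.
exact: row_degree_bound DP.
Qed.

Lemma eval_coefs_scale_rows S :
  exists2 D, (#|S| * d ^ n.-1 <= D)%N & forall F t, homogeneous d F -> t != 0 ->
    eval_coefs Res (fun k => if k \in S then t *: F k else F k)
    = t ^+ D * eval_coefs Res F.
Proof.
rewrite cardE; have : uniq (enum S) by apply: enum_uniq.
have eqS F t : (fun k => if k \in S then t *: F k else F k)
    =1 (fun k => if k \in enum S then t *: F k else F k).
  by move=> k; rewrite mem_enum.
move: eqS; move: (enum S) => s eqS.
suff: uniq s -> exists2 D, (size s * d ^ n.-1 <= D)%N &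
    forall F t, homogeneous d F -> t != 0 ->
    eval_coefs Res (fun k => if k \in s then t *: F k else F k)
    = t ^+ D * eval_coefs Res F.
  move=> /[apply] -[D sD DP]; exists D => // F t hF t0.
  by rewrite (eq_eval_coefs _ (eqS F t)) DP.
move=> {eqS}; elim: s => [_|i s IHs /andP[iNs /IHs[D sD DP]]].
  by exists 0%N => // F t _ _; rewrite mul1r; apply: eq_eval_coefs.
have [E dE EP] := eval_coefs_scale_row_ge i.
exists (E + D)%N => [|F t hF t0]; first by rewrite /= mulSn leq_add.
rewrite exprD -mulrA -DP // -EP //; last first.
  by move=> k; case: ifP => _; rewrite ?dhomogZ ?hF.
apply: eq_eval_coefs => k; rewrite /scale_row in_cons.
by have [->|] := eqVneq k i; rewrite ?(negPf iNs).
Qed.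

Lemma eval_coefs_pencil F G :
  exists p : {poly C}, forall u, p.[u] = eval_coefs Res (fun k => F k + u *: G k).
Proof.
exists (res_at Res (fun j => (coefs F j)%:P + 'X * (coefs G j)%:P)) => u.
rewrite horner_res_at eval_coefsE; apply: eq_res_at => j.
by rewrite !hornerE /coefs mcoeffD mcoeffZ.
Qed.

(* Along F - u G, where G collects the row combinations, the common zeros do not
   depend on u, so the resultant is a polynomial in u that has no root unless it
   vanishes identically. *)
Lemma eval_coefs_row_reduction S (c : 'I_n -> 'I_n -> C) F : homogeneous d F ->
  eval_coefs Res
    (fun k => if k \in S then F k - \sum_(i | i \notin S) c k i *: F i else F k)
  = eval_coefs Res F.
Proof.
move=> hF.
pose G : system := fun k => if k \in S then - \sum_(i | i \notin S) c k i *: F i else 0.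
pose H u : system := fun k => F k + u *: G k.
have hG : homogeneous d G.
  move=> k; rewrite /G; case: ifP => _; last exact: rpred0.
  by rewrite rpredN; apply: rpred_sum => i _; apply/dhomogZ/hF.
have hH u : homogeneous d (H u) by move=> k; apply/dhomogD/dhomogZ/hG; apply: hF.
have Hz u v : eval_coefs Res (H u) != 0 -> eval_coefs Res (H v) != 0.
  apply: eval_coefs_neq0_sub (hH u) (hH v) _ => // x xH.
  have F0 i : i \notin S -> (F i).@[fun l => x l 0] = 0.
    by move=> iS; have := xH i; rewrite /H /G (negPf iS) scaler0 addr0.
  have G0 k : (G k).@[fun l => x l 0] = 0.
    rewrite /G; case: ifP => _; last exact: meval0.
    rewrite mevalN (raddf_sum (meval _)) big1 ?oppr0 // => i iS /=.
    by rewrite mevalZ F0 // mulr0.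
  by move=> k; have := xH k; rewrite /H !mevalD !mevalZ !G0 !mulr0.
have [p pE] := eval_coefs_pencil F G.
have H0 : H 0 =1 F by move=> k; rewrite /H scale0r addr0.
transitivity (eval_coefs Res (H 1)).
  apply: eq_eval_coefs => k; rewrite /H /G scale1r.
  by case: ifP => _; rewrite ?addr0.
rewrite -(eq_eval_coefs _ H0) -!pE.
have [p0|pn0] := eqVneq p.[0] 0.
  apply/eqP; rewrite p0; apply: contraTT isT; rewrite pE => /(Hz _ 0).
  by rewrite -pE p0 eqxx.
have [c' ->] : exists c', p = c'%:P; last by rewrite !hornerC.
suff /eqP/size_poly1P[c' _ ->] : size p = 1%N by exists c'.
apply/eqP/closed_rootP => -[u /rootP].
by rewrite pE => /eqP; apply/negP/(Hz 0); rewrite -pE.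
Qed.

End RowOperations.

(** * Forms of a tensor and its characteristic polynomial *)

Section TensorForms.

(** Contracting the m-th power of a with m - 1 copies of x gives (a^T x)^(m-1) a; distributivity
    expands that power into the sum over all tuples. *)
Lemma tapply_decomp (K : comNzRingType) n m r (T : tensor K n m)
    (a : 'I_r -> 'cV[K]_n) (x : 'cV[K]_n) i : (0 < m)%N -> sym_decomp T a ->
  tapply T x i 0 =
    \sum_(k < r) a k i 0 * (\sum_(l < n) a k l 0 * x l 0) ^+ m.-1.
Proof.
case: m T => // d T _ TE; rewrite /= mxE.
have {}TE j : T j = \sum_(k < r) tpower d.+1 (a k) j by rewrite TE; apply: sum_ffunE.
transitivity (\sum_(j : d.-tuple 'I_n) \sum_(k < r)
    tpower d.+1 (a k) [ffun l : 'I_d.+1 => nth i (i :: j) l] * \prod_(l <- j) x l 0).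
  by apply: eq_bigr => j _; rewrite TE mulr_suml.
rewrite exchange_big /=; apply: eq_bigr => k _.
rewrite -[X in _ ^+ X]card_ord -prodr_const bigA_distr_bigA /= mulr_sumr.
rewrite (reindex_onto (@tuple_of_finfun _ d) (@finfun_of_tuple _ d)) /=; last first.
  by move=> j _; rewrite finfun_of_tupleK.
apply: eq_big => [j|j _]; first by rewrite tuple_of_finfunK eqxx.
rewrite big_split /= !ffunE big_ord_recl !ffunE /= -mulrA; congr (_ * (_ * _)).
  by apply: eq_bigr => l _; rewrite ffunE lift0 /= (nth_map l) ?size_enum_ord // nth_ord_enum.
by rewrite big_map big_enum.
Qed.

Lemma tensor_forms_sum (K : comNzRingType) n m (T : tensor K n m) i :
  tensor_forms T i = \sum_(j : m.-1.-tuple 'I_n)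
    T [ffun k : 'I_m => nth i (i :: j) k] *: \prod_(l <- j) 'X_l.
Proof.
rewrite /tensor_forms mxE; apply: eq_bigr => j _; rewrite ffunE mul_mpolyC.
by congr (_ *: _); apply: eq_bigr => l _; rewrite mxE.
Qed.

Lemma homogeneous_tensor_forms (C : numClosedFieldType) n m (T : tensor C n m) :
  homogeneous m.-1 (tensor_forms T).
Proof.
move=> i; rewrite tensor_forms_sum; apply: rpred_sum => j _; apply: dhomogZ.
rewrite -[X in X.-homog](size_tuple j); elim: (tval j) => [|l s IHs].
  by rewrite big_nil dhomog1.
have hl : ('X_l : {mpoly C[n]}) \is 1.-homog by rewrite dhomogX /= mdeg1.
by rewrite big_cons; have := dhomogM hl IHs; rewrite add1n.
Qed.

Lemma map_tensor_forms (K L : comNzRingType) (f : {rmorphism K -> L}) n m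
    (T : tensor K n m) i :
  map_mpoly f (tensor_forms T i) = tensor_forms ([ffun j => f (T j)] : tensor L n m) i.
Proof.
rewrite !tensor_forms_sum (raddf_sum (map_mpoly f)); apply: eq_bigr => j _ /=.
rewrite map_mpolyZ ffunE (rmorph_prod (map_mpoly f)); congr (_ *: _).
by apply: eq_bigr => l _ /=; rewrite map_mpolyX.
Qed.

Lemma tensor_forms_id (K : comNzRingType) n m i : (0 < m)%N ->
  tensor_forms (id_tensor K n m) i = 'X_i ^+ m.-1.
Proof.
case: m => // d _; rewrite tensor_forms_sum /=.
rewrite (bigD1 [tuple of nseq d i]) //= [X in _ + X]big1 ?addr0.
  rewrite /= big_nseq iter_mulr_1 ffunE.
  suff -> : [forall k, forall l, [ffun k : 'I_d.+1 => nth i (i :: nseq d i) k] k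
        == [ffun k : 'I_d.+1 => nth i (i :: nseq d i) k] l] by rewrite scale1r.
  apply/forallP => k; apply/forallP => l; rewrite !ffunE.
  have nthE e : nth i (i :: nseq d i) e = i by case: e => //= e; rewrite nth_nseq if_same.
  by rewrite !nthE.
move=> j ji; rewrite ffunE; case: forallP => [/(_ ord0)/forallP jE|]; last first.
  by rewrite scale0r.
case/eqP: ji; apply/eq_from_tnth => l; apply/esym/eqP.
have := jE (lift ord0 l); rewrite !ffunE /= -tnth_nth.
by rewrite (tnth_nth i [tuple of nseq d i]) /= nth_nseq ltn_ord.
Qed.

(** Evaluation at z is a ring morphism, so it commutes with the resultant and with taking forms. *)
Lemma horner_tensor_charpoly (C : numClosedFieldType) n m
    (Res : {mpoly int[#|coef_index n m.-1|]}) (T : tensor C n m) (z : C) :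
  (0 < m)%N ->
  (tensor_charpoly Res T).[z]
  = eval_coefs Res (fun i => z *: 'X_i ^+ m.-1 - tensor_forms T i).
Proof.
move=> m_gt0; rewrite eval_coefsE.
pose TX : tensor {poly C} n m := [ffun j => 'X * id_tensor {poly C} n m j - (T j)%:P].
have -> : tensor_charpoly Res T = res_at Res (fun j => (tensor_forms TX j.1)@_(val j.2)).
  by [].
rewrite horner_res_at; apply: eq_res_at => j; rewrite -[LHS]/(horner_eval z _) -mcoeff_map_mpoly.
rewrite (map_tensor_forms (horner_eval z)) /coefs; congr (_@_ _).
rewrite -tensor_forms_id // !tensor_forms_sum scaler_sumr -sumrB.
apply: eq_bigr => t _; rewrite scalerA -scalerBl !ffunE /=; congr (_ *: _).
rewrite horner_evalE !hornerE; congr (_ * _ - _).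
by case: [forall _, _]; rewrite hornerE.
Qed.

End TensorForms.

(** * Algebraic multiplicity of zero *)

Section AlgebraicMultiplicity.
Variables (C : numClosedFieldType) (n m r : nat).
Variable Res : {mpoly int[#|coef_index n m.-1|]}.
Variables (T : tensor C n m) (a : 'I_r -> 'cV[C]_n).
Hypotheses (ResP : is_resultant C Res) (m_gt1 : (1 < m)%N).

Let d_gt0 : (0 < m.-1)%N. Proof. by case: m m_gt1 => [|[]]. Qed.
Let m_gt0 : (0 < m)%N. Proof. exact: ltnW. Qed.

(** Multiplicity is read as divisibility only for a nonzero polynomial. Up to a power of t, its
    value at 1/t is the resultant of the forms of I - t T, a polynomial in t with value 1 at t =
    0. *)
Lemma tensor_charpoly_neq0 : (0 < n)%N -> tensor_charpoly Res T != 0.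
Proof.
move=> n_gt0.
pose F i : {mpoly C[n]} := 'X_i ^+ m.-1.
pose G i : {mpoly C[n]} := - tensor_forms T i.
have homF : homogeneous m.-1 F.
  by move=> i; rewrite /F -(tensor_forms_id C i m_gt0); apply: homogeneous_tensor_forms.
have homG : homogeneous m.-1 G.
  by move=> i; rewrite dhomogN; apply: homogeneous_tensor_forms.
have [g gE] := eval_coefs_pencil Res F G.
have g0 : g != 0.
  suff: g.[0] != 0 by apply: contraNneq => ->; rewrite horner0.
  rewrite gE (@eq_eval_coefs _ _ _ _ _ F) => [|i]; last by rewrite scale0r addr0.
  by case: ResP => _ _ ->; apply: oner_neq0.
have /closed_nonrootP[t] : g * 'X != 0 by rewrite mulf_neq0 // polyX_eq0.
rewrite rootE hornerM hornerX mulf_eq0 negb_or => /andP[gt t0].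
suff : (tensor_charpoly Res T).[t^-1] != 0.
  by apply: contraNneq => ->; rewrite horner0.
rewrite horner_tensor_charpoly //.
have [D _ DP] := eval_coefs_scale_rows ResP d_gt0 [set: 'I_n].
have := DP (fun i => F i + t *: G i) t^-1.
rewrite invr_eq0 -gE => /(_ _ t0) E.
rewrite (@eq_eval_coefs _ _ _ _ _ 
  (fun k => if k \in [set: 'I_n] then t^-1 *: (F k + t *: G k) else F k + t *: G k)).
  rewrite E ?mulf_neq0 ?expf_neq0 ?invr_neq0 // => i.
  by apply: dhomogD => //; apply: dhomogZ.
by move=> k; rewrite inE scalerDr scalerA mulVf // scale1r.
Qed.

Hypotheses (decT : sym_decomp T a) (rank_a : \rank (decomp_mx a) = r).

Lemma tensor_forms_decomp i :
  tensor_forms T i =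
    \sum_(k < r) a k i 0 *: (\sum_(l < n) a k l 0 *: 'X_l) ^+ m.-1.
Proof.
rewrite /tensor_forms (@tapply_decomp _ _ _ r _ (fun k => map_mx (@mpolyC n C) (a k))) //.
  apply: eq_bigr => k _; rewrite mxE mul_mpolyC; congr (_ *: _ ^+ _).
  by apply: eq_bigr => l _; rewrite !mxE mul_mpolyC.
apply/ffunP => j; rewrite ffunE decT.
transitivity (\sum_(k < r) (tpower m (a k) j)%:MP_[n] : {mpoly C[n]}).
  by rewrite -rmorph_sum; congr _%:MP; apply: sum_ffunE.
transitivity (\sum_(k < r) tpower m (map_mx (@mpolyC n C) (a k)) j); last first.
  by apply/esym/sum_ffunE.
apply: eq_bigr => k _; rewrite !ffunE rmorph_prod.
by apply: eq_bigr => l _; rewrite mxE.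
Qed.

Lemma row_dependency : exists S : {set 'I_n}, exists c : 'M[C]_n,
  #|S| = (n - r)%N /\
  forall i k, a k i 0 = \sum_(j | j \notin S) c i j * a k j 0.
Proof.
have fullA : row_full (decomp_mx a) by rewrite /row_full rank_a.
pose f := fullrankfun fullA.
pose S := ~: [set f k | k : 'I_r].
(* The rows outside S already span the row space, so A factors as c B even with the rows in S set to
   zero. *)
pose B : 'M[C]_(n, r) := \matrix_(i, k) if i \in S then 0 else a k i 0.
have /submxP[c cE] : (decomp_mx a <= B)%MS.
  apply: submx_trans (submx_full _ (fullrowsub_full fullA)) _.
  apply/row_subP => k; suff -> : row k (rowsub f (decomp_mx a)) = row (f k) B.
    exact: row_sub.
  by apply/rowP => l; rewrite !mxE !inE imset_f.
exists S, c; split.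
  rewrite cardsCs finset.setCK card_imset ?card_ord //.
  by move=> x y; apply: fullrankfun_inj.
move=> i k; have := congr1 (fun M : 'M__ => M i k) cE; rewrite !mxE => ->.
rewrite [RHS]big_mkcond /=; apply: eq_bigr => j _; rewrite !mxE.
by case: ifP => _ /=; rewrite ?mulr0.
Qed.

(* Subtracting combinations of the other rows turns the forms of
   [lambda I - T] with index in S into multiples of lambda. *)
Lemma am0_ge : (0 < n)%N -> ((n - r) * m.-1 ^ n.-1 <= am Res T 0)%N.
Proof.
move=> n_gt0; have [S [c [cardS cP]]] := row_dependency.
(* Form i combines the powers (a_k^T x)^(m-1) with coefficients from row i of A, so dependencies
   among rows pass to forms. *)
have phiE i : tensor_forms T i = \sum_(j | j \notin S) c i j *: tensor_forms T j.
  under eq_bigr => j _ do rewrite tensor_forms_decomp scaler_sumr.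
  rewrite exchange_big tensor_forms_decomp; apply: eq_bigr => k _ /=.
  rewrite cP scaler_suml; apply: eq_bigr => j _.
  by rewrite scalerA.
rewrite mup_geq ?tensor_charpoly_neq0 // subr0.
have homX i : ('X_i ^+ m.-1 : {mpoly C[n]}) \is m.-1.-homog.
  by rewrite -(tensor_forms_id C i m_gt0); apply: homogeneous_tensor_forms.
have homT i : tensor_forms T i \is m.-1.-homog by apply: homogeneous_tensor_forms.
pose K k : {mpoly C[n]} := 'X_k ^+ m.-1 - \sum_(i | i \notin S) c k i *: 'X_i ^+ m.-1.
have homK k : K k \is m.-1.-homog.
  by apply: rpredB => //; apply: rpred_sum => i _; apply: dhomogZ.
(* After the reduction, row k in S is t [K k]; h is the resultant with these factors t removed. *)
have [h hE] := eval_coefs_pencil Res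
  (fun k => if k \in S then K k else - tensor_forms T k)
  (fun k => if k \in S then 0 else 'X_k ^+ m.-1).
have [D leD DP] := eval_coefs_scale_rows ResP d_gt0 S.
suff -> : tensor_charpoly Res T = 'X^D * h.
  by rewrite dvdp_mulr // dvdp_exp2l // -cardS.
apply: poly_eq_horner_neq0 => t t0.
rewrite horner_tensor_charpoly // hornerM hornerXn hE -DP //; last first.
  move=> k; case: ifP => _; first by rewrite scaler0 addr0.
  by apply: dhomogD; rewrite ?dhomogN // dhomogZ.
rewrite -(eval_coefs_row_reduction ResP S (fun k i => c k i)); last first.
  by move=> i; apply: rpredB => //; apply: dhomogZ.
apply: eq_eval_coefs => k; case: ifP => _; last by rewrite addrC.
rewrite scaler0 addr0 /K scalerBr scaler_sumr {1}phiE -addrA -opprD -big_split /=.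
congr (_ - _); apply: eq_bigr => i _.
by rewrite scalerBr addrC subrK !scalerA mulrC.
Qed.

End AlgebraicMultiplicity.

(** * Krull dimension of linear spaces *)

Section IrreducibleSets.
Variables (C : closedFieldType) (n : nat).
Implicit Types (Z V : set 'cV[C]_n) (x y : 'cV[C]_n) (p f : {mpoly C[n]}).

Local Notation value x p := (p.@[fun i => x i 0]).

(** The zero sets of p and q are closed and together cover Z. *)
Lemma irreducible_mul Z p q : zariski_irreducible Z ->
  (forall x, Z x -> value x p * value x q = 0) ->
  (forall x, Z x -> value x p = 0) \/ (forall x, Z x -> value x q = 0).
Proof.
move=> [_ irrZ] pq.
have closed1 f : zariski_closed [set x | value x f = 0].
  exists [set f]%classic; apply/seteqP; split=> x /=; first by move=> fx _ ->.
  exact.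
have [||] := irrZ _ _ (closed1 p) (closed1 q).
- by move=> x /pq/eqP; rewrite mulf_eq0 => /orP[] /eqP; [left | right].
- by left.
- by right.
Qed.

(** Some equation defining the closed set [Z i] must fail at a point of the larger [Z i.+1]. *)
Lemma chain_separating V k (Z : nat -> set 'cV[C]_n) : irreducible_chain V k Z ->
  exists f : nat -> {mpoly C[n]}, forall i, (i < k)%N ->
    (forall x, Z i x -> value x (f i) = 0) /\ (exists2 x, Z i.+1 x & value x (f i) != 0).
Proof.
move=> [ZP Zlt].
suff /boolp.choice[f fP] : forall i, exists p, (i < k)%N ->
    (forall x, Z i x -> value x p = 0) /\ (exists2 x, Z i.+1 x & value x p != 0).
  by exists f.
move=> i; have [ik|_] := boolP (i < k)%N; last by exists 0.
have [[S ZE] _ _] := ZP i (ltnW ik).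
have [_ /existsNP[x /not_implyP[Zx]]] := Zlt i ik.
rewrite [in X in ~ X]ZE => /existsNP[p /not_implyP[Sp /eqP px]].
by exists p => _; split=> [y|]; [rewrite ZE; apply | exists x].
Qed.

End IrreducibleSets.

(** * Algebraic independence along a chain *)

(** Nested pairs let an induction on k split off the last exponent. *)
Fixpoint exponents (N k : nat) : finType :=
  if k is k'.+1 then (exponents N k' * 'I_N)%type else unit.

Lemma card_exponents N k : #|exponents N k| = (N ^ k)%N.
Proof.
elim: k => [|k IHk]; first by rewrite card_unit.
by rewrite card_prod IHk card_ord expnSr.
Qed.

Fixpoint monomial (A : comNzRingType) (f : nat -> A) N k : exponents N k -> A :=
  match k with
  | 0 => fun=> 1
  | k'.+1 => fun e => monomial f e.1 * f k' ^+ e.2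
  end.

Lemma rmorph_monomial (A B : comNzRingType) (h : {rmorphism A -> B})
    (f : nat -> A) N k (e : exponents N k) :
  h (monomial f e) = monomial (fun i => h (f i)) e.
Proof.
elim: k e => [|k IHk] e /=; first exact: rmorph1.
by rewrite rmorphM rmorphXn /= IHk.
Qed.

Section AlgebraicIndependence.
Variables (C : closedFieldType) (n : nat).

Local Notation value x p := (p.@[fun i => x i 0]).

(* If f_0, ..., f_k satisfy a relation on Z_(k+1), cancel the largest power of
   f_k dividing it (Z_(k+1) is irreducible and f_k is not zero there), then
   restrict to Z_k, where f_k = 0. *)
Lemma chain_algebraic_independence V k (Z : nat -> set 'cV[C]_n)
    (f : nat -> {mpoly C[n]}) N :
  irreducible_chain V k Z ->
  (forall i, (i < k)%N -> (forall x, Z i x -> value x (f i) = 0) /\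
                          (exists2 x, Z i.+1 x & value x (f i) != 0)) ->
  forall c : exponents N k -> C,
  (forall x, Z k x -> \sum_e c e * value x (monomial f e) = 0) -> forall e, c e = 0.
Proof.
move=> [ZP Zlt] fP; elim: k ZP Zlt fP => [|k IHk] ZP Zlt fP c.
  have [_ [[x Zx] _] _] := ZP 0%N isT => /(_ _ Zx).
  rewrite (big_pred1 tt) => [|[]] //= + [].
  by rewrite meval1 mulr1.
move=> c0.
have {}IHk : forall c : exponents N k -> C,
    (forall x, Z k x -> \sum_e c e * value x (monomial f e) = 0) -> forall e, c e = 0.
  apply: IHk => i ik; [exact: ZP (leqW ik) | exact: Zlt (ltnW ik) | exact: fP (ltnW ik)].
have [fk0 [y Zy fky]] := fP k (ltnSn k).
have [_ irrZ _] := ZP k.+1 (leqnn _).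
suff low b : forall e : exponents N k.+1, (e.2 < b)%N -> c e = 0 by move=> e; apply: (low e.2.+1).
elim: b => // b IHb.
(* The relation divided by f_k^b: the terms of lower exponent vanish by induction on b. *)
pose Q : {mpoly C[n]} := \sum_(e : exponents N k.+1 | (b <= e.2)%N)
   c e *: (monomial f e.1 * f k ^+ (e.2 - b)).
have QE x : value x Q = \sum_(e : exponents N k.+1 | (b <= e.2)%N)
    c e * (value x (monomial f e.1) * value x (f k) ^+ (e.2 - b)).
  rewrite (raddf_sum (meval _)); apply: eq_bigr => e _ /=.
  by rewrite mevalZ mevalM (rmorphXn (meval _)).
have Q0 x : Z k.+1 x -> value x Q = 0.
  have [|fb0|Qx /Qx //] := @irreducible_mul _ _ _ (f k ^+ b) Q irrZ.
    move=> {}x Zx; rewrite -[RHS](c0 x Zx) QE mulr_sumr [RHS](bigID (fun e : exponents N k.+1 => (b <= e.2)%N)) /=.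
    rewrite [X in _ = _ + X]big1 ?addr0; last first.
      by move=> e; rewrite -ltnNge => /IHb ->; rewrite mul0r.
    apply: eq_bigr => e be; rewrite mulrCA mevalM !(rmorphXn (meval _)) /=.
    by congr (_ * _); rewrite mulrCA -exprD subnKC.
  have := fb0 y Zy; rewrite (rmorphXn (meval _)) /= => /eqP.
  by rewrite expf_eq0 (negPf fky) andbF.
move=> e; rewrite ltnS leq_eqVlt => /orP[/eqP eb|]; last exact: IHb.
rewrite [e]surjective_pairing; move: e.1 (e.2) eb => w j jb.
apply: (IHk (fun w => c (w, j))) => x Zx.
have [ZZ _] := Zlt k (ltnSn k); rewrite -[RHS](Q0 x (ZZ x Zx)) QE.
transitivity (\sum_(v : exponents N k) \sum_(l < N | (b <= l)%N)
    c (v, l) * (value x (monomial f v) * value x (f k) ^+ (l - b))); last first.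
  by rewrite pair_big_dep; apply: eq_big => [[v l]|[v l] _].
apply: eq_bigr => v _; rewrite (bigD1 j) ?jb //= subnn expr0 mulr1 big1 ?addr0 //.
(* On [Z k] only the terms with last exponent exactly b survive. *)
move=> l /andP[bl lj]; rewrite fk0 // expr0n subn_eq0.
case: leqP => [lb|_]; last by rewrite !mulr0.
by case/eqP: lj; apply: val_inj; apply/eqP; rewrite /= jb eqn_leq lb bl.
Qed.

End AlgebraicIndependence.

(** * Algebraic dependence by counting monomials *)

Section Counting.
Variables (C : fieldType) (q : nat).

Lemma card_bmultinom_le E : (#|{: 'X_{1..q < E.+1}}| <= E.+1 ^ q)%N.
Proof.
pose h (m : 'X_{1..q < E.+1}) : {ffun 'I_q -> 'I_E.+1} := [ffun i => inord (m i)].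
have le_m (m : 'X_{1..q < E.+1}) i : (m i < E.+1)%N.
  apply: leq_ltn_trans (bmdeg m); rewrite mdegE (bigD1 i) //=; exact: leq_addr.
have h_inj : injective h.
  move=> m1 m2 /ffunP hm; apply/val_inj/mnmP => i.
  by have := congr1 (@nat_of_ord _) (hm i); rewrite !ffunE !inordK.
by have := leq_card _ h_inj; rewrite card_ffun !card_ord.
Qed.

(** [msize] is the degree plus one, and 0 at the zero polynomial; bounds of the form [e.+1] let
    degrees add without truncation. *)
Lemma msizeM_bound (p1 p2 : {mpoly C[q]}) e1 e2 :
  (msize p1 <= e1.+1)%N -> (msize p2 <= e2.+1)%N -> (msize (p1 * p2) <= (e1 + e2).+1)%N.
Proof.
move=> le1 le2; have [->|p10] := eqVneq p1 0; first by rewrite mul0r msize0.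
have [->|p20] := eqVneq p2 0; first by rewrite mulr0 msize0.
rewrite msizeM // -subn1 leq_subLR add1n -addSn -addnS.
exact: leq_add.
Qed.

Lemma msize_monomial (g : nat -> {mpoly C[q]}) D N k (e : exponents N k) :
  (forall i, (i < k)%N -> msize (g i) <= D.+1)%N ->
  (msize (monomial g e) <= (k * (N * D)).+1)%N.
Proof.
elim: k e => [|k IHk] e gD /=; first by rewrite msize1.
rewrite mulSn addnC; apply: msizeM_bound.
  by apply: IHk => i ik; apply: gD (ltnW ik).
suff E b : (msize (g k ^+ b) <= (b * D).+1)%N.
  by apply: leq_trans (E _) _; rewrite ltnS leq_mul2r ltnW ?orbT.
elim: b => [|b IHb]; first by rewrite expr0 msize1.
by rewrite exprS mulSn; apply: msizeM_bound => //; apply: gD.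
Qed.

(* The N^k monomials with exponents < N in k polynomials of degree at most D lie
   in a space of dimension at most (k N D + 1)^q, which is smaller for large N. *)
Lemma algebraic_dependence (g : nat -> {mpoly C[q]}) k : (q < k)%N ->
  exists N, exists c : exponents N k -> C,
    (exists e, c e != 0) /\ \sum_e c e *: monomial g e = 0.
Proof.
move=> qk; pose D := \max_(i < k) msize (g i).
have gD i : (i < k)%N -> (msize (g i) <= D.+1)%N.
  by move=> ik; apply: leqW; apply: (leq_bigmax (Ordinal ik)).
(* This N gives (kND + 1)^q <= N^q (kD + 1)^q < N^(q+1) <= N^k. *)
pose N := ((k * D).+1 ^ q).+1; exists N.
pose E := (k * (N * D))%N.
have dimE : (#|{: 'X_{1..q < E.+1}}| < #|exponents N k|)%N.
  apply: leq_ltn_trans (card_bmultinom_le _) _; rewrite card_exponents.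
  apply: (@leq_trans (N ^ q.+1)%N); last by rewrite leq_pexp2l.
  rewrite expnS; apply: (@leq_ltn_trans ((N * (k * D).+1) ^ q)%N).
    case: q => [|q'] //; rewrite leq_exp2r // mulnS /E mulnCA addnC -addn1.
    exact: leq_add.
  by rewrite expnMn mulnC ltn_pmul2r // expn_gt0.
pose M : 'M[C]_(#|exponents N k|, #|{: 'X_{1..q < E.+1}}|) :=
  \matrix_(i, j) (monomial g (enum_val i))@_(val (enum_val j)).
have /rowV0Pn[v /sub_kermxP vM v0] : kermx M != 0.
  rewrite -mxrank_eq0 mxrank_ker subn_eq0 -ltnNge.
  exact: leq_ltn_trans (rank_leq_col _) dimE.
exists (fun e => v 0 (enum_rank e)); split.
  have /existsP[i vi] : [exists i, v 0 i != 0].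
    apply: contraNT v0 => /existsPn v0; apply/eqP/rowP => i; rewrite mxE.
    by apply/eqP; have := v0 i; rewrite negbK.
  by exists (enum_val i); rewrite enum_valK.
apply/mpolyP => m; rewrite mcoeff0 (raddf_sum (mcoeff m)) /=.
have [mE|Em] := ltnP (mdeg m) E.+1; last first.
  rewrite big1 // => e _; rewrite mcoeffZ [X in _ * X](_ : _ = 0) ?mulr0 //.
  apply/eqP; rewrite mcoeff_eq0; apply: msize_mdeg_ge.
  exact: leq_trans (msize_monomial _ gD) Em.
have := congr1 (fun A : 'M__ => A 0 (enum_rank (BMultinom mE))) vM.
rewrite !mxE => vM0; rewrite -[RHS]vM0 (reindex_onto (@enum_val _ _) (@enum_rank _)) /=; last first.
  by move=> e _; rewrite enum_rankK.
apply: eq_big => [i|i _]; first by rewrite enum_valK eqxx.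
by rewrite mcoeffZ enum_valK !mxE enum_rankK.
Qed.

End Counting.

(** * Linear spaces as algebraic sets *)

Section LinearSets.
Variables (C : closedFieldType) (n : nat).
Local Notation value x p := (p.@[fun i => x i 0]).

Definition linear_set q (W : 'M[C]_(q, n)) : set 'cV[C]_n :=
  [set x | (x^T <= W)%MS]%classic.

Lemma linear_set_closed q (W : 'M[C]_(q, n)) : zariski_closed (linear_set W).
Proof.
pose form k : {mpoly C[n]} := \sum_i cokermx W i k *: 'X_i.
have formE k (x : 'cV[C]_n) : value x (form k) = (x^T *m cokermx W) 0 k.
  rewrite (raddf_sum (meval _)) mxE; apply: eq_bigr => i _ /=.
  by rewrite mevalZ mevalXU [x^T _ _]mxE mulrC.
exists [set form k | k in setT]%classic; apply/seteqP; split=> x /=.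
  by rewrite /linear_set /= submxE => /eqP x0 _ [k _ <-]; rewrite formE x0 mxE.
move=> x0; rewrite /linear_set /= submxE; apply/eqP/rowP => k.
by rewrite -formE mxE x0 //; exists k.
Qed.

(* Two polynomials that are not zero on the set are not zero at two of its points;
   on the line through them both become nonzero polynomials in one variable. *)
Lemma linear_set_irreducible q (W : 'M[C]_(q, n)) : zariski_irreducible (linear_set W).
Proof.
split; first by exists 0; rewrite /linear_set /= trmx0 sub0mx.
move=> Z1 Z2 [S1 ->] [S2 ->] WZ; apply/or_asboolP/negPn/negP.
rewrite negb_or => /andP[/asboolPn n1 /asboolPn n2].
have sep (S : set {mpoly C[n]}) :
    ~ (linear_set W `<=` [set x | forall p, S p -> value x p = 0])%classic ->
    exists x p, [/\ linear_set W x, S p & value x p != 0].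
  move=> /existsNP[x /not_implyP[Wx /existsNP[p /not_implyP[Sp /eqP px]]]].
  by exists x, p.
have [x1 [p1 [W1 S1p1 nz1]]] := sep _ n1.
have [x2 [p2 [W2 S2p2 nz2]]] := sep _ n2.
pose line t : 'cV[C]_n := x1 + t *: (x2 - x1).
pose restrict p : {poly C} :=
  mmap (@polyC C) (fun i => (x1 i 0)%:P + 'X * (x2 i 0 - x1 i 0)%:P) p.
have restrictE p t : (restrict p).[t] = value (line t) p.
  rewrite /restrict /mmap mevalE horner_sum; apply: eq_bigr => m _.
  rewrite hornerM hornerC /mmap1 horner_prod; congr (_ * _); apply: eq_bigr => i _.
  by rewrite horner_exp !hornerE !mxE.
have line0 : line 0 = x1 by rewrite /line scale0r addr0.
have line1 : line 1 = x2 by rewrite /line scale1r addrC subrK.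
have nz1' : restrict p1 != 0.
  by apply: contraNneq nz1 => r0; rewrite -line0 -restrictE r0 horner0.
have nz2' : restrict p2 != 0.
  by apply: contraNneq nz2 => r0; rewrite -line1 -restrictE r0 horner0.
have /closed_nonrootP[t] : restrict p1 * restrict p2 != 0 by rewrite mulf_neq0.
rewrite rootE hornerM !restrictE mulf_eq0 negb_or => /andP[/eqP t1 /eqP t2].
have [|Z1t|Z2t] := WZ (line t); [|exact: t1 (Z1t _ _)|exact: t2 (Z2t _ _)].
rewrite /linear_set /= /line linearD linearZ linearB /=.
by rewrite addmx_sub // scalemx_sub // addmx_sub // eqmx_opp.
Qed.

(** Substituting the parametrization y W turns k > q separating polynomials into polynomials in q
    variables; their algebraic relation then holds on [Z k], against independence. *)
Lemma linear_set_chain_le q (W : 'M[C]_(q, n)) k (Z : nat -> set 'cV[C]_n) :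
  irreducible_chain (linear_set W) k Z -> (k <= q)%N.
Proof.
move=> ZP; rewrite leqNgt; apply/negP => qk.
have [f fP] := chain_separating ZP.
pose lq : n.-tuple {mpoly C[q]} := [tuple \sum_j W j l *: 'X_j | l < n].
have [N [c [[e0 ce0] c0]]] := algebraic_dependence (fun i => f i \mPo lq) qk.
have /eqP : c e0 = 0; last by rewrite (negPf ce0).
apply: (chain_algebraic_independence ZP fP) => x Zx.
have [_ _ ZW] := ZP.1 k (leqnn k).
have /submxP[y xE] := ZW _ Zx.
have xy p : value x p = (p \mPo lq).@[fun j => y 0 j].
  rewrite comp_mpoly_meval; apply: meval_eq => l.
  rewrite tnth_mktuple (raddf_sum (meval _)) /=.
  have := congr1 (fun A : 'M__ => A 0 l) xE; rewrite !mxE => ->.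
  by apply: eq_bigr => j _; rewrite mevalZ mevalXU mulrC.
have := congr1 (meval (fun j => y 0 j)) c0; rewrite meval0 (raddf_sum (meval _)) /=.
move=> c0y; rewrite -[RHS]c0y; apply: eq_bigr => e _; rewrite mevalZ xy; congr (_ * meval _ _).
exact: (rmorph_monomial (comp_mpoly lq)).
Qed.

Lemma linear_set_krull_dim q (W : 'M[C]_(q, n)) : row_free W ->
  has_krull_dim (linear_set W) q.
Proof.
move=> freeW; split; last by move=> k Z; apply: linear_set_chain_le.
(* [U i] keeps the first i rows of W; the spans form a flag, strict because the ranks grow. *)
pose U i : 'M[C]_(q, n) := (pid_mx i : 'M[C]_q) *m W.
have rankU i : (i <= q)%N -> \rank (U i) = i.
  by move=> iq; rewrite mxrankMfree // rank_pid_mx.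
exists (fun i => linear_set (U i)); split=> i iq.
  split; [exact: linear_set_closed | exact: linear_set_irreducible |].
  by move=> x; rewrite /linear_set /= => /submx_trans; apply; apply: submxMl.
split=> [x|WW]; rewrite /linear_set /=.
  move=> /submx_trans; apply; rewrite /U.
  have -> : (pid_mx i : 'M[C]_q) = (pid_mx i : 'M[C]_q) *m (pid_mx i.+1 : 'M[C]_q).
    by rewrite mul_pid_mx (minn_idPl (leqnSn i)) pid_mx_minv.
  by rewrite -mulmxA submxMl.
have /mxrankS : (U i.+1 <= U i)%MS.
  apply/row_subP => l; have := WW (row l (U i.+1))^T.
  by rewrite /linear_set /= trmxK; apply; apply: row_sub.
by rewrite !rankU // ?ltnn // ltnW.
Qed.

Lemma has_krull_dim_unique (V : set 'cV[C]_n) d1 d2 :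
  has_krull_dim V d1 -> has_krull_dim V d2 -> d1 = d2.
Proof.
move=> [[Z1 ch1] max1] [[Z2 ch2] max2]; apply/eqP.
by rewrite eqn_leq (max2 _ _ ch1) (max1 _ _ ch2).
Qed.

Lemma affine_dimE (V : set 'cV[C]_n) d : has_krull_dim V d -> affine_dim V = d.
Proof.
by move=> Vd; apply: xget_unique => // d' /has_krull_dim_unique; apply.
Qed.

End LinearSets.

(** * Geometric multiplicity of zero and conclusion *)

Lemma gm0_sym_decomp (C : closedFieldType) n m r (T : tensor C n m) (a : 'I_r -> 'cV[C]_n) :
  (1 < m)%N -> sym_decomp T a -> \rank (decomp_mx a) = r -> gm T 0 = (n - r)%N.
Proof.
move=> m_gt1 decT rank_a; rewrite -rank_a -mxrank_ker.
pose A := decomp_mx a; rewrite -/A.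
have -> : gm T 0 = affine_dim (linear_set (row_base (kermx A))).
  congr affine_dim; apply/seteqP; split=> x.
    rewrite /eigenvariety /linear_set /= scale0r eq_row_base => Tx0.
    pose y : 'cV[C]_r := \col_k (x^T *m A) 0 k ^+ m.-1.
    have Ay0 : A *m y = 0.
      apply/colP => i; have := congr1 (fun v : 'cV__ => v i 0) Tx0.
      rewrite (tapply_decomp _ _ (ltnW m_gt1) decT) !mxE => Tx0i.
      rewrite -[RHS]Tx0i; apply: eq_bigr => k _; rewrite !mxE; congr (_ * _ ^+ _).
      by apply: eq_bigr => l _; rewrite !mxE mulrC.
    (* The columns of A are independent, so A y = 0 forces y = 0. *)
    have y0 : y = 0.
      have : row_free A^T by rewrite /row_free mxrank_tr rank_a.
      move=> /row_freeP[B AB]; apply: trmx_inj; rewrite trmx0.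
      by rewrite -[y^T]mulmx1 -AB mulmxA -trmx_mul Ay0 trmx0 mul0mx.
    apply/sub_kermxP/rowP => k; have := congr1 (fun v : 'cV__ => v k 0) y0.
    by rewrite !mxE => /eqP; rewrite expf_eq0 => /andP[_ /eqP].
  rewrite /eigenvariety /linear_set /= scale0r eq_row_base => /sub_kermxP xA.
  apply/colP => i; rewrite (tapply_decomp _ _ (ltnW m_gt1) decT) mxE big1 // => k _.
  have := congr1 (fun v : 'rV__ => v 0 k) xA; rewrite !mxE => xAk.
  rewrite (_ : \sum_l _ = 0) ?expr0n; last first.
    by rewrite -[RHS]xAk; apply: eq_bigr => l _; rewrite !mxE mulrC.
  (* The power 0^(m-1) is 0 because m > 1. *)
  by case: m m_gt1 {T decT} => [|[]] // m' _; rewrite mulr0.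
exact/affine_dimE/linear_set_krull_dim/row_base_free.
Qed.

Theorem proposition4p3 (R : realType) (m n r s : nat)
    (Res : {mpoly int[#|coef_index n m.-1|]})
    (T : tensor R[i] n m) (a : 'I_r -> 'cV[R[i]]_n) :
  (2 <= m)%N -> (1 <= n)%N ->
  is_resultant R[i] Res ->
  symmetric_tensor T ->
  sym_decomp T a ->
  \rank (decomp_mx a) = r ->
  r = mrank T ->
  mrank T = s ->
  (s <= n)%N ->
  gm T 0 = (n - s)%N /\
  ((n - s) * m.-1 ^ n.-1 <= am Res T 0)%N /\
  (gm T 0%R * m.-1 ^ (gm T 0%R).-1 <= (n - s) * m.-1 ^ n.-1)%N.
Proof.
move=> m_gt1 n_gt0 ResP _ decT rank_a rE sE _.
have rs : r = s by rewrite rE.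
have gmE : gm T 0 = (n - s)%N by rewrite -rs; apply: gm0_sym_decomp decT rank_a.
split=> //; split; first by rewrite -rs; apply: am0_ge decT rank_a n_gt0.
(* The first factors agree; the base m - 1 is positive and the exponents compare as n - s - 1 <= n -
   1. *)
rewrite gmE leq_mul2l leq_pexp2l ?orbT //; first by case: m m_gt1 {T Res ResP decT gmE rE sE} => [|[]].
by rewrite -!subn1 leq_sub2r // leq_subr.
Qed.
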